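(* For every integer $k \geq 3$, the variety of $k$-nilpotent groups (regarded as a category, with all group homomorphisms as morphisms) is not weakly action representable.
   Context: The variety of $k$-nilpotent groups is the full subcategory of the category of groups consisting of all groups that are nilpotent of class at most $k$, i.e. groups $G$ with $G^k = 1$, where $G^0 = G$ and $G^{j} = [G, G^{j-1}]$ for $j\ge 1$. Let $\mathcal{C}$ be a semi-abelian category (every variety of groups is one). For objects $B, X$ of $\mathcal{C}$, a split extension of $B$ by $X$ is a diagram $X \xrightarrow{\,\kappa\,} A \overset{\alpha}{\underset{\beta}{\rightleftarrows}} B$ in $\mathcal{C}$ (with $\alpha\colon A \to B$, $\beta \colon B \to A$) such that $\alpha\circ\beta = \mathrm{id}_B$ and $(X,\kappa)$ is a kernel of $\alpha$. Two split extensions $(A,\kappa,\alpha,\beta)$ and $(A',\kappa',\alpha',\beta')$ of $B$ by $X$ are isomorphic if there is an isomorphism $\theta\colon A \to A'$ with $\theta\kappa = \kappa'$, $\alpha'\theta = \alpha$ and $\theta\beta = \beta'$. For a fixed object $X$, the functor $\mathrm{SplExt}(-,X)\colon \mathcal{C}^{op}\to \mathbf{Set}$ sends $B$ to the set of isomorphism classes of split extensions (in $\mathcal{C}$) of $B$ by $X$, and sends $f\colon B'\to B$ to the map $f^*\colon \mathrm{SplExt}(B,X)\to \mathrm{SplExt}(B',X)$ given by pulling back along $f$. The category $\mathcal{C}$ is weakly action representable if for every object $X$ of $\mathcal{C}$ there exist an object $T = T(X)$ of $\mathcal{C}$ and a natural monomorphism of functors (a natural transformation with all components injective) $\tau\colon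 \mathrm{SplExt}(-,X) \rightarrowtail \mathrm{Hom}_{\mathcal{C}}(-,T)$. *)

(* Defs.v *)
From HB Require Import structures.
From mathcomp Require Import all_boot.
From mathcomp Require Import boolp classical_sets.

Set Implicit Arguments.
Unset Strict Implicit.
Unset Printing Implicit Defensive.

Local Open Scope classical_set_scope.
Local Open Scope group_scope.

Record category := Category {
  obj :> Type;
  hom : obj -> obj -> Type;
  idm : forall A, hom A A;
  mcomp : forall A B D, hom B D -> hom A B -> hom A D;
  compA : forall A B D E (h : hom D E) (g : hom B D) (f : hom A B),
    mcomp h (mcomp g f) = mcomp (mcomp h g) f;
  comp1m : forall A B (f : hom A B), mcomp (idm B) f = f;
  compm1 : forall A B (f : hom A B), mcomp f (idm A) = f }.

Arguments hom {c} : rename.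
Arguments idm {c} A : rename.
Arguments mcomp {c A B D} : rename.
Arguments compA {c A B D E} : rename.
Arguments comp1m {c A B} : rename.
Arguments compm1 {c A B} : rename.

Declare Scope category_scope.
Delimit Scope category_scope with cat.
Local Open Scope category_scope.
Notation "g '\oc' f" := (mcomp g f)
  (at level 40, left associativity) : category_scope.

(* Split extensions and their pullback functor make sense in every category
   with a zero object and pullbacks, in particular in a semi-abelian one.
   A choice of both is part of the structure. *)
Record pointed_pb_category := PointedPbCategory {
  pcat :> category;
  zero : pcat;
  to_zero : forall A : pcat, hom A zero;
  from_zero : forall A : pcat, hom zero A;
  to_zeroE : forall (A : pcat) (f : hom A zero), f = to_zero A;
  from_zeroE : forall (A : pcat) (f : hom zero A), f = from_zero A;
  pb : forall A B D : pcat, hom A D -> hom B D -> pcat;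
  pb1 : forall (A B D : pcat) (f : hom A D) (g : hom B D), hom (pb f g) A;
  pb2 : forall (A B D : pcat) (f : hom A D) (g : hom B D), hom (pb f g) B;
  pb_comm : forall (A B D : pcat) (f : hom A D) (g : hom B D),
    f \oc pb1 f g = g \oc pb2 f g;
  pb_lift : forall (A B D : pcat) (f : hom A D) (g : hom B D) (Z : pcat)
    (u : hom Z A) (v : hom Z B), f \oc u = g \oc v -> hom Z (pb f g);
  pb_lift1 : forall (A B D : pcat) (f : hom A D) (g : hom B D) (Z : pcat)
    (u : hom Z A) (v : hom Z B) (uv : f \oc u = g \oc v),
    pb1 f g \oc pb_lift uv = u;
  pb_lift2 : forall (A B D : pcat) (f : hom A D) (g : hom B D) (Z : pcat)
    (u : hom Z A) (v : hom Z B) (uv : f \oc u = g \oc v),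
    pb2 f g \oc pb_lift uv = v;
  pb_uniq : forall (A B D : pcat) (f : hom A D) (g : hom B D) (Z : pcat)
    (w w' : hom Z (pb f g)),
    pb1 f g \oc w = pb1 f g \oc w' -> pb2 f g \oc w = pb2 f g \oc w' ->
    w = w' }.

Section SplitExtensions.
Variable C : pointed_pb_category.
Implicit Types A B D X Z : C.

Definition zerom A B : hom A B := from_zero B \oc to_zero A.

Lemma zerom_comp A B D (f : hom A B) : zerom B D \oc f = zerom A D.
Proof. by rewrite /zerom -compA (to_zeroE (to_zero B \oc f)). Qed.

Lemma comp_zerom A B D (f : hom B D) : f \oc zerom A B = zerom A D.
Proof. by rewrite /zerom compA (from_zeroE (f \oc from_zero B)). Qed.

Definition is_kernel X A B (kappa : hom X A) (alpha : hom A B) : Prop :=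
  alpha \oc kappa = zerom X B /\
  forall Z (g : hom Z A), alpha \oc g = zerom Z B ->
    exists! h : hom Z X, kappa \oc h = g.

Record split_ext B X := SplitExt {
  se_obj : C;
  se_kappa : hom X se_obj;
  se_alpha : hom se_obj B;
  se_beta : hom B se_obj;
  se_split : se_alpha \oc se_beta = idm B;
  se_kernel : is_kernel se_kappa se_alpha }.

Definition is_iso A B (f : hom A B) : Prop :=
  exists g : hom B A, g \oc f = idm A /\ f \oc g = idm B.

Definition split_ext_iso B X (E E' : split_ext B X) : Prop :=
  exists theta : hom (se_obj E) (se_obj E'),
    [/\ is_iso theta,
        theta \oc se_kappa E = se_kappa E',
        se_alpha E' \oc theta = se_alpha E &
        theta \oc se_beta E = se_beta E'].

Section Pullback.
Variables (B B' X : C) (f : hom B' B) (E : split_ext B X).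
Let alpha := se_alpha E.

Lemma pb_kappa_subproof : alpha \oc se_kappa E = f \oc zerom X B'.
Proof. by rewrite (se_kernel E).1 comp_zerom. Qed.

Lemma pb_beta_subproof : alpha \oc (se_beta E \oc f) = f \oc idm B'.
Proof. by rewrite compA se_split comp1m compm1. Qed.

Definition pb_kappa : hom X (pb alpha f) := pb_lift pb_kappa_subproof.
Definition pb_beta : hom B' (pb alpha f) := pb_lift pb_beta_subproof.

Lemma pb_split : pb2 alpha f \oc pb_beta = idm B'.
Proof. exact: pb_lift2. Qed.

Lemma pb_kernel : is_kernel pb_kappa (pb2 alpha f).
Proof.
split=> [|Z g g0]; first exact: pb_lift2.
have /(se_kernel E).2[h [hg huniq]] : alpha \oc (pb1 alpha f \oc g) = zerom Z B.
  by rewrite compA pb_comm -compA g0 comp_zerom.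
exists h; split=> [|h' h'g].
  by apply: pb_uniq; rewrite compA (pb_lift1, pb_lift2) ?zerom_comp.
by apply: huniq; rewrite -h'g compA pb_lift1.
Qed.

Definition split_ext_pb : split_ext B' X := SplitExt pb_split pb_kernel.

End Pullback.

(* Classes are bare predicates: mathcomp's [set T] forces T into the universe of
   choiceTypes, which is too small for the split extensions of groups. *)
Definition iso_class B X (E : split_ext B X) : split_ext B X -> Prop :=
  fun E' => split_ext_iso E E'.

Definition SplExt B X :=
  {c : split_ext B X -> Prop | exists E, c = iso_class E}.

Definition SplExt_pi B X (E : split_ext B X) : SplExt B X :=
  exist _ (iso_class E) (ex_intro _ E erefl).

Lemma split_ext_iso_refl B X (E : split_ext B X) : split_ext_iso E E.
Proof.
exists (idm _); split; rewrite ?comp1m ?compm1 //.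
by exists (idm _); rewrite comp1m.
Qed.

Lemma split_ext_iso_sym B X (E E' : split_ext B X) :
  split_ext_iso E E' -> split_ext_iso E' E.
Proof.
move=> [t [[s [st ts]] tk at_ tb]]; exists s; split.
- by exists t.
- by rewrite -tk compA st comp1m.
- by rewrite -at_ -compA ts compm1.
- by rewrite -tb compA st comp1m.
Qed.

Lemma split_ext_iso_trans B X (E E' E'' : split_ext B X) :
  split_ext_iso E E' -> split_ext_iso E' E'' -> split_ext_iso E E''.
Proof.
move=> [t [[s [st ts]] tk at_ tb]] [t' [[s' [st' ts']] tk' at' tb']].
exists (t' \oc t); split.
- exists (s \oc s'); split.
    by rewrite -compA (compA s') st' comp1m.
  by rewrite -compA (compA t) ts comp1m.
- by rewrite -compA tk.
- by rewrite compA at'.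
- by rewrite -compA tb.
Qed.

Lemma SplExt_piP B X (E E' : split_ext B X) :
  SplExt_pi E = SplExt_pi E' <-> split_ext_iso E E'.
Proof.
split=> [/(congr1 sval)/= EE'|EE'].
  suff : iso_class E E' by [].
  by rewrite EE'; exact: split_ext_iso_refl.
apply: eq_exist => /=; apply/predeqP => F; split; apply: split_ext_iso_trans => //.
exact: split_ext_iso_sym.
Qed.

Lemma SplExt_piE B X (c : SplExt B X) : exists E, c = SplExt_pi E.
Proof. by case: c => c [E cE]; exists E; exact: eq_exist. Qed.

Lemma split_ext_pb_iso B B' X (f : hom B' B) (E E' : split_ext B X) :
  split_ext_iso E E' -> split_ext_iso (split_ext_pb f E) (split_ext_pb f E').
Proof.
have lift_eq (F F' : split_ext B X) (t : hom (se_obj F) (se_obj F')) :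
    se_alpha F' \oc t = se_alpha F ->
    se_alpha F' \oc (t \oc pb1 (se_alpha F) f) = f \oc pb2 (se_alpha F) f.
  by move=> tF; rewrite compA tF pb_comm.
move=> [t [[s [st ts]] tk at_ tb]].
have as_ : se_alpha E \oc s = se_alpha E' by rewrite -at_ -compA ts compm1.
exists (pb_lift (lift_eq _ _ _ at_)); split.
- exists (pb_lift (lift_eq _ _ _ as_)); split; apply: pb_uniq;
    rewrite compA compm1 ?pb_lift1 ?pb_lift2 -?compA ?pb_lift1 ?pb_lift2 //.
    by rewrite compA st comp1m.
  by rewrite compA ts comp1m.
- by apply: pb_uniq; rewrite compA ?pb_lift1 ?pb_lift2 // -?compA ?pb_lift1.
- exact: pb_lift2.
- by apply: pb_uniq; rewrite compA ?pb_lift1 ?pb_lift2 // -compA pb_lift1 compA tb.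
Qed.

Lemma SplExt_map_subproof B B' X (f : hom B' B) (c : SplExt B X) :
  exists E', (fun F => exists2 E, sval c E & split_ext_iso (split_ext_pb f E) F)
             = iso_class E'.
Proof.
have [E ->] := SplExt_piE c; exists (split_ext_pb f E).
apply/predeqP => F; split=> [[E' EE']|EF].
  exact/split_ext_iso_trans/split_ext_pb_iso.
by exists E; first exact: split_ext_iso_refl.
Qed.

Definition SplExt_map B B' X (f : hom B' B) (c : SplExt B X) : SplExt B' X :=
  exist _ _ (SplExt_map_subproof f c).

Lemma SplExt_mapE B B' X (f : hom B' B) (E : split_ext B X) :
  SplExt_map f (SplExt_pi E) = SplExt_pi (split_ext_pb f E).
Proof.
apply: eq_exist => /=; apply/predeqP => F; split=> [[E' EE']|EF].
  exact/split_ext_iso_trans/split_ext_pb_iso.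
by exists E; first exact: split_ext_iso_refl.
Qed.

Lemma SplExt_map1 B X (c : SplExt B X) : SplExt_map (idm B) c = c.
Proof.
have [E ->] := SplExt_piE c; rewrite SplExt_mapE; apply/SplExt_piP.
have e : se_alpha E \oc idm (se_obj E) = idm B \oc se_alpha E.
  by rewrite compm1 comp1m.
have pbE : pb2 (se_alpha E) (idm B) = se_alpha E \oc pb1 (se_alpha E) (idm B).
  by rewrite pb_comm comp1m.
exists (pb1 _ _); split.
- exists (pb_lift e); rewrite pb_lift1; split=> //.
  apply: pb_uniq; rewrite compA compm1; first by rewrite pb_lift1 comp1m.
  by rewrite pb_lift2 pbE.
- by rewrite pb_lift1.
- by rewrite -pbE.
- by rewrite pb_lift1 compm1.
Qed.

Lemma SplExt_mapM B B' B'' X (f : hom B' B) (g : hom B'' B') (c : SplExt B X) :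
  SplExt_map (f \oc g) c = SplExt_map g (SplExt_map f c).
Proof.
have [E ->] := SplExt_piE c; rewrite !SplExt_mapE; apply/SplExt_piP.
set a := se_alpha E.
have e1 : a \oc pb1 a (f \oc g) = f \oc (g \oc pb2 a (f \oc g)).
  by rewrite pb_comm compA.
have e2 : pb2 a f \oc pb_lift e1 = g \oc pb2 a (f \oc g) by rewrite pb_lift2.
have e3 : a \oc (pb1 a f \oc pb1 (pb2 a f) g) = (f \oc g) \oc pb2 (pb2 a f) g.
  by rewrite compA pb_comm -!compA pb_comm.
exists (pb_lift e2); split=> /=.
- exists (pb_lift e3); split.
    apply: pb_uniq; rewrite compA compm1 ?pb_lift1 ?pb_lift2 //.
    by rewrite -compA pb_lift1 pb_lift1.
  apply: pb_uniq; rewrite compA compm1 ?pb_lift1 ?pb_lift2 //.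
  apply: pb_uniq; rewrite compA ?pb_lift1 ?pb_lift2 ?pb_lift1 //.
  by rewrite -compA pb_lift2 pb_comm.
- apply: pb_uniq; rewrite compA ?pb_lift1 ?pb_lift2 //.
  by apply: pb_uniq; rewrite compA ?pb_lift1 ?pb_lift2 // -compA pb_lift2 comp_zerom.
- exact: pb_lift2.
- apply: pb_uniq; rewrite compA ?pb_lift1 ?pb_lift2 //.
  by apply: pb_uniq; rewrite !compA ?pb_lift1 ?pb_lift2 ?comp1m
     -?compA ?pb_lift2 ?compm1.
Qed.

End SplitExtensions.

Definition weakly_action_representable (C : pointed_pb_category) : Prop :=
  forall X : C, exists (T : C) (tau : forall B : C, SplExt B X -> hom B T),
    (forall B : C, injective (tau B)) /\
    (forall (B B' : C) (f : hom B' B) (c : SplExt B X),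
       tau B' (SplExt_map f c) = tau B c \oc f).

Definition subgroup (G : groupType) (H : set G) : Prop :=
  [/\ H 1, forall x y, H x -> H y -> H (x * y) & forall x, H x -> H x^-1].

Definition commutator_subgroup (G : groupType) (H K : set G) : set G :=
  smallest (@subgroup G) [set [~ x, y] | x in H & y in K].

Fixpoint lower_central (G : groupType) (j : nat) : set G :=
  if j is j'.+1 then commutator_subgroup setT (@lower_central G j') else setT.

Arguments lower_central : clear implicits.

Notation group_hom := UMagmaMorphism.type.

Lemma group_hom_eq (G H : groupType) (f g : group_hom G H) : f =1 g -> f = g.
Proof.
case: f g => f [[fM] [f1]] [g [[gM] [g1]]] /= /funext fg; subst g.
by rewrite (Prop_irrelevance fM gM) (Prop_irrelevance f1 g1).
Qed.

Lemma lower_central_hom (G H : groupType) (f : group_hom G H) j x :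
  lower_central G j x -> lower_central H j (f x).
Proof.
elim: j x => [//|j IHj] x /= xj A sA.
have [[A1 AM AV] RA] := sA.
apply: (xj (f @^-1` A)); split=> [|_ [y _ [z zj <-]]] /=; last first.
  by rewrite gmulfR; apply: RA; exists (f y) => //; exists (f z) => //; exact: IHj.
split=> [|y z|y] /=; rewrite ?gmulf1 ?gmulfM ?gmulfV //; [exact: AM | exact: AV].
Qed.

Lemma lower_central1 (G : groupType) j : lower_central G j 1.
Proof. by case: j => [//|j] A [[]]. Qed.

(* A groupType carries a choice operator; classically every group has one, and
   homomorphisms ignore it, so that this is no restriction. *)
Record nilgroup (k : nat) := NilGroup {
  nilgroup_group :> groupType;
  nilgroupP : lower_central nilgroup_group k = [set 1] }.

HB.instance Definition _ := @isGroup.Build unit tt (fun=> tt) (fun _ _ => tt)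
  (fun _ _ _ => erefl) (fun 'tt => erefl) (fun 'tt => erefl)
  (fun=> erefl) (fun=> erefl).

Section FiberProduct.
Variables (A B D : groupType) (f : group_hom A D) (g : group_hom B D).

Definition fiber_pred : pred (A * B) := [pred x | f x.1 == g x.2].

Lemma fiber_pred_closed : group_closed fiber_pred.
Proof.
split=> [|x y]; rewrite !inE /= ?gmulf1 // => /eqP fx /eqP fy.
by rewrite !gmulfF fx fy.
Qed.

Definition fiber : Type := {x : A * B | fiber_pred x}.
HB.instance Definition _ := SubChoice.on fiber.
HB.instance Definition _ :=
  SubChoice_isSubGroup.Build (A * B)%type fiber_pred fiber fiber_pred_closed.

Definition fiber1 (x : fiber) : A := (val x).1.
Definition fiber2 (x : fiber) : B := (val x).2.

Lemma fiber1_is_hom : monoid_morphism fiber1. Proof. by []. Qed.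
Lemma fiber2_is_hom : monoid_morphism fiber2. Proof. by []. Qed.
HB.instance Definition _ := isUMagmaMorphism.Build fiber A fiber1 fiber1_is_hom.
HB.instance Definition _ := isUMagmaMorphism.Build fiber B fiber2 fiber2_is_hom.

End FiberProduct.

Section FiberProductUniversal.
Variables (A B D Z : groupType) (f : group_hom A D) (g : group_hom B D).
Variables (u : group_hom Z A) (v : group_hom Z B).
Hypothesis uv : f \o u =1 g \o v.

Lemma fiber_lift_subproof z : fiber_pred f g (u z, v z).
Proof. exact/eqP/uv. Qed.

Definition fiber_lift (z : Z) : fiber f g := Sub _ (fiber_lift_subproof z).

Lemma fiber_lift_is_hom : monoid_morphism fiber_lift.
Proof.
by split=> [|x y]; apply: val_inj; rewrite /= ?gmulf1 ?gmulfM.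
Qed.
HB.instance Definition _ :=
  isUMagmaMorphism.Build Z (fiber f g) fiber_lift fiber_lift_is_hom.

End FiberProductUniversal.

Section NilpotentGroups.
Variable k : nat.
Implicit Types A B D Z : nilgroup k.

Definition group_id (G : groupType) : group_hom G G := idfun.
Definition group_comp (G H K : groupType) (g : group_hom H K)
  (f : group_hom G H) : group_hom G K := g \o f.
Definition group_one (G H : groupType) : group_hom G H := one_fun H.

Lemma unit_nilpotent : lower_central unit k = [set 1].
Proof.
by apply/predeqP => -[]; split=> // _; exact: lower_central1.
Qed.

Lemma fiber_nilpotent A B D (f : group_hom A D) (g : group_hom B D) :
  lower_central (fiber f g) k = [set 1].
Proof.
apply/predeqP => x; split=> [xk|->]; last exact: lower_central1.
have := lower_central_hom (@fiber1 _ _ _ f g) xk.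
have := lower_central_hom (@fiber2 _ _ _ f g) xk.
rewrite !nilgroupP /= /fiber1 /fiber2 => x2 x1.
by apply: val_inj; rewrite [LHS]surjective_pairing x1 x2.
Qed.

Lemma group_compA A B D (E : nilgroup k) (h : group_hom D E) (g : group_hom B D)
  (f : group_hom A B) :
  group_comp h (group_comp g f) = group_comp (group_comp h g) f.
Proof. exact: group_hom_eq. Qed.

Lemma group_comp1m A B (f : group_hom A B) : group_comp (group_id B) f = f.
Proof. exact: group_hom_eq. Qed.

Lemma group_compm1 A B (f : group_hom A B) : group_comp f (group_id A) = f.
Proof. exact: group_hom_eq. Qed.

Definition nil_cat : category :=
  @Category (nilgroup k) (fun A B => group_hom A B) (fun A => group_id A)
    (fun A B D => @group_comp A B D) group_compA group_comp1m group_compm1.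

Definition nil_zero : nilgroup k := NilGroup unit_nilpotent.

Lemma nil_to_zeroE A (f : group_hom A nil_zero) : f = group_one A nil_zero.
Proof. by apply: group_hom_eq => x; case: (f x). Qed.

Lemma nil_from_zeroE A (f : group_hom nil_zero A) : f = group_one nil_zero A.
Proof. by apply: group_hom_eq => -[]; exact: gmulf1. Qed.

Section Pullback.
Variables (A B D : nilgroup k) (f : group_hom A D) (g : group_hom B D).

Definition nil_pb : nilgroup k := NilGroup (fiber_nilpotent f g).
Definition nil_pb1 : group_hom nil_pb A := @fiber1 A B D f g.
Definition nil_pb2 : group_hom nil_pb B := @fiber2 A B D f g.

Lemma nil_pb_comm : group_comp f nil_pb1 = group_comp g nil_pb2.
Proof. by apply: group_hom_eq => x; exact/eqP/(valP x). Qed.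

Variables (Z : nilgroup k) (u : group_hom Z A) (v : group_hom Z B).
Hypothesis uv : group_comp f u = group_comp g v.

Lemma nil_pb_lift_subproof : f \o u =1 g \o v.
Proof. by move=> z; exact: (congr1 (fun h : group_hom Z D => h z) uv). Qed.

Definition nil_pb_lift : group_hom Z nil_pb := fiber_lift nil_pb_lift_subproof.

Lemma nil_pb_lift1 : group_comp nil_pb1 nil_pb_lift = u.
Proof. exact: group_hom_eq. Qed.

Lemma nil_pb_lift2 : group_comp nil_pb2 nil_pb_lift = v.
Proof. exact: group_hom_eq. Qed.

Lemma nil_pb_uniq (w w' : group_hom Z nil_pb) :
  group_comp nil_pb1 w = group_comp nil_pb1 w' ->
  group_comp nil_pb2 w = group_comp nil_pb2 w' -> w = w'.
Proof.
move=> e1 e2; apply: group_hom_eq => z; apply: val_inj.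
rewrite [LHS]surjective_pairing [RHS]surjective_pairing; congr (_, _).
  exact: (congr1 (fun h : group_hom Z A => h z) e1).
exact: (congr1 (fun h : group_hom Z B => h z) e2).
Qed.

End Pullback.

Definition nilpotent_groups : pointed_pb_category :=
  @PointedPbCategory nil_cat nil_zero
    (fun A => group_one A nil_zero) (fun A => group_one nil_zero A)
    nil_to_zeroE nil_from_zeroE nil_pb nil_pb1 nil_pb2 nil_pb_comm
    nil_pb_lift nil_pb_lift1 nil_pb_lift2 nil_pb_uniq.

End NilpotentGroups.

(* Main.v *)
(* Let X = Z^3 with the usual action of the Heisenberg group B of integral upper
   unitriangular matrices, so that the semidirect product A of X by B is the
   group of unitriangular 4x4 matrices, of class 3. Twisting X by the
   transposition s of its last two coordinates gives two split extensions E1, E2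
   of B by X. Since e12 = s e13 s, they become isomorphic when restricted to the
   subgroup <e12, e13> = Z^2 of B along its inclusion i and along i composed
   with the swap of Z^2, respectively. If SplExt(-, X) embeds into Hom(-, T),
   then E1, E2 give t1, t2 : B -> T with t1 e12^a = t2 e13^a, t2 e12^a = t1 e13^a.
   As e13^a is a commutator of e12^a in B, each of t1 e12^a, t2 e12^a is a
   commutator of the other, hence both lie in every term of the lower central
   series of T, and are trivial. Thus t1 i = 1, so that the restriction of E1
   along i is isomorphic to the trivial one, although e12 does not act trivially
   on X. *)
From HB Require Import structures.
From mathcomp Require Import all_boot.
From mathcomp Require Import ssralg ssrint ring.
From mathcomp Require Import boolp classical_sets.
Require Import Defs.

Set Implicit Arguments.
Unset Strict Implicit.
Unset Printing Implicit Defensive.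

Local Open Scope classical_set_scope.
Local Open Scope group_scope.
Local Open Scope category_scope.

(** * Lower central series under inclusions and embeddings *)

Lemma lower_central_sub (G : groupType) (j : nat) (L : set G) :
  subgroup L ->
  (forall x y, lower_central G j y -> L [~ x, y]) ->
  lower_central G j.+1 `<=` L.
Proof. by move=> sL LR x; apply; split=> // _ [y _ [z zj <-]]; exact: LR. Qed.

Lemma subgroup1 (G : groupType) : subgroup [set 1 : G].
Proof. by split=> [//|_ _ -> ->|_ ->] /=; rewrite ?mulg1 ?invg1. Qed.

Lemma lower_central_trivial (G : groupType) (j k : nat) :
  j <= k -> lower_central G j = [set 1] -> lower_central G k = [set 1].
Proof.
move=> /subnK <- Gj; elim: (k - j) => [//|n IHn]; rewrite addSn.
apply/seteqP; split=> [|_ ->]; last exact: lower_central1.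
apply: lower_central_sub => [|x y]; first exact: subgroup1.
by rewrite IHn => ->; rewrite /= commg1.
Qed.

Lemma lower_central_inj (G H : groupType) (f : group_hom G H) (k : nat) :
  injective f -> lower_central H k = [set 1] -> lower_central G k = [set 1].
Proof.
move=> f_inj Hk; apply/seteqP; split=> [x xk|_ ->]; last exact: lower_central1.
by apply: f_inj; rewrite gmulf1; have := lower_central_hom f xk; rewrite Hk.
Qed.

(** * Twisting a split extension by an involution of its kernel *)

Lemma twist_kernel (C : pointed_pb_category) (X A B : C) (kappa : hom X A)
    (alpha : hom A B) (s : hom X X) :
  s \oc s = idm X -> is_kernel kappa alpha -> is_kernel (kappa \oc s) alpha.
Proof.
move=> ss [ak kU]; split=> [|Z g /kU[h [<- hU]]].
  by rewrite compA ak zerom_comp.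
exists (s \oc h); split=> [|h' e].
  by rewrite -compA (compA s s) ss comp1m.
by rewrite (hU (s \oc h')) ?compA -?e ?ss ?comp1m.
Qed.

Definition split_ext_twist (C : pointed_pb_category) (X B : C)
    (E : split_ext B X) (s : hom X X) (ss : s \oc s = idm X) : split_ext B X :=
  SplitExt (se_split E) (twist_kernel ss (se_kernel E)).

(** * The four groups in integer coordinates *)

Lemma pair_eq (T U : Type) (x x' : T) (y y' : U) :
  x = x' -> y = y' -> (x, y) = (x', y').
Proof. by move=> -> ->. Qed.

Ltac coords := rewrite /=; repeat apply: pair_eq; rewrite /=; ring.

(* (a, c) stands for e12^a e13^c. *)
Definition vec2 : Type := int * int.
HB.instance Definition _ := Choice.on vec2.

(* (x, y, z) is a column vector. *)
Definition vec3 : Type := int * int * int.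
HB.instance Definition _ := Choice.on vec3.

(* (p, q, r) is the matrix [[1, p, r], [0, 1, q], [0, 0, 1]]. *)
Definition heis : Type := int * int * int.
HB.instance Definition _ := Choice.on heis.

(* (v, m) is the matrix [[m, v], [0, 1]]. *)
Definition ut4 : Type := vec3 * heis.
HB.instance Definition _ := Choice.on ut4.

Section Operations.
Local Open Scope ring_scope.

Definition vec2_one : vec2 := (0, 0).
Definition vec2_inv (v : vec2) : vec2 := let: (a, c) := v in (- a, - c).
Definition vec2_mul (v w : vec2) : vec2 :=
  let: (a, c) := v in let: (a', c') := w in (a + a', c + c').

Definition vec3_one : vec3 := (0, 0, 0).
Definition vec3_inv (v : vec3) : vec3 := let: (x, y, z) := v in (- x, - y, - z).
Definition vec3_mul (v w : vec3) : vec3 :=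
  let: (x, y, z) := v in let: (x', y', z') := w in (x + x', y + y', z + z').

Definition heis_one : heis := (0, 0, 0).
Definition heis_inv (m : heis) : heis :=
  let: (p, q, r) := m in (- p, - q, p * q - r).
Definition heis_mul (m n : heis) : heis :=
  let: (p, q, r) := m in let: (p', q', r') := n in
  (p + p', q + q', r + r' + p * q').

Definition heis_act (m : heis) (v : vec3) : vec3 :=
  let: (p, q, r) := m in let: (x, y, z) := v in
  (x + p * y + r * z, y + q * z, z).

Definition ut4_one : ut4 := (vec3_one, heis_one).
Definition ut4_inv (g : ut4) : ut4 :=
  let: (v, m) := g in (heis_act (heis_inv m) (vec3_inv v), heis_inv m).
Definition ut4_mul (g h : ut4) : ut4 :=
  let: (v, m) := g in let: (w, n) := h in
  (vec3_mul v (heis_act m w), heis_mul m n).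

Fact vec2_mulA : associative vec2_mul.
Proof. by move=> [? ?] [? ?] [? ?]; coords. Qed.
Fact vec2_mul1r : left_id vec2_one vec2_mul.
Proof. by move=> [? ?]; coords. Qed.
Fact vec2_mulr1 : right_id vec2_one vec2_mul.
Proof. by move=> [? ?]; coords. Qed.
Fact vec2_mulVr : left_inverse vec2_one vec2_inv vec2_mul.
Proof. by move=> [? ?]; coords. Qed.
Fact vec2_mulrV : right_inverse vec2_one vec2_inv vec2_mul.
Proof. by move=> [? ?]; coords. Qed.

Fact vec3_mulA : associative vec3_mul.
Proof. by move=> [[? ?] ?] [[? ?] ?] [[? ?] ?]; coords. Qed.
Fact vec3_mul1r : left_id vec3_one vec3_mul.
Proof. by move=> [[? ?] ?]; coords. Qed.
Fact vec3_mulr1 : right_id vec3_one vec3_mul.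
Proof. by move=> [[? ?] ?]; coords. Qed.
Fact vec3_mulVr : left_inverse vec3_one vec3_inv vec3_mul.
Proof. by move=> [[? ?] ?]; coords. Qed.
Fact vec3_mulrV : right_inverse vec3_one vec3_inv vec3_mul.
Proof. by move=> [[? ?] ?]; coords. Qed.

Fact heis_mulA : associative heis_mul.
Proof. by move=> [[? ?] ?] [[? ?] ?] [[? ?] ?]; coords. Qed.
Fact heis_mul1r : left_id heis_one heis_mul.
Proof. by move=> [[? ?] ?]; coords. Qed.
Fact heis_mulr1 : right_id heis_one heis_mul.
Proof. by move=> [[? ?] ?]; coords. Qed.
Fact heis_mulVr : left_inverse heis_one heis_inv heis_mul.
Proof. by move=> [[? ?] ?]; coords. Qed.
Fact heis_mulrV : right_inverse heis_one heis_inv heis_mul.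
Proof. by move=> [[? ?] ?]; coords. Qed.

Fact ut4_mulA : associative ut4_mul.
Proof.
move=> [[[? ?] ?] [[? ?] ?]] [[[? ?] ?] [[? ?] ?]] [[[? ?] ?] [[? ?] ?]]; coords.
Qed.
Fact ut4_mul1r : left_id ut4_one ut4_mul.
Proof. by move=> [[[? ?] ?] [[? ?] ?]]; coords. Qed.
Fact ut4_mulr1 : right_id ut4_one ut4_mul.
Proof. by move=> [[[? ?] ?] [[? ?] ?]]; coords. Qed.
Fact ut4_mulVr : left_inverse ut4_one ut4_inv ut4_mul.
Proof. by move=> [[[? ?] ?] [[? ?] ?]]; coords. Qed.
Fact ut4_mulrV : right_inverse ut4_one ut4_inv ut4_mul.
Proof. by move=> [[[? ?] ?] [[? ?] ?]]; coords. Qed.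

End Operations.

HB.instance Definition _ := isGroup.Build vec2
  vec2_mulA vec2_mul1r vec2_mulr1 vec2_mulVr vec2_mulrV.
HB.instance Definition _ := isGroup.Build vec3
  vec3_mulA vec3_mul1r vec3_mulr1 vec3_mulVr vec3_mulrV.
HB.instance Definition _ := isGroup.Build heis
  heis_mulA heis_mul1r heis_mulr1 heis_mulVr heis_mulrV.
HB.instance Definition _ := isGroup.Build ut4
  ut4_mulA ut4_mul1r ut4_mulr1 ut4_mulVr ut4_mulrV.

(** * Nilpotency of the unitriangular group *)

Definition ut4_level1 : set ut4 :=
  [set g | exists x y r : int, g = ((x, y, 0%R), (0%R, 0%R, r))].
Definition ut4_level2 : set ut4 :=
  [set g | exists x : int, g = ((x, 0%R, 0%R), (0%R, 0%R, 0%R))].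

Lemma ut4_level1_subgroup : subgroup ut4_level1.
Proof.
split=> [|_ _ [x [y [r ->]]] [x' [y' [r' ->]]]|_ [x [y [r ->]]]].
- by exists 0%R, 0%R, 0%R.
- by exists (x + x')%R, (y + y')%R, (r + r')%R; coords.
- by exists (- x)%R, (- y)%R, (- r)%R; coords.
Qed.

Lemma ut4_level2_subgroup : subgroup ut4_level2.
Proof.
split=> [|_ _ [x ->] [x' ->]|_ [x ->]].
- by exists 0%R.
- by exists (x + x')%R; coords.
- by exists (- x)%R; coords.
Qed.

(** The superdiagonal entries [p], [q], [z] add up under multiplication, so they vanish on
    commutators. *)
Lemma ut4_commg1 (g h : ut4) : ut4_level1 [~ g, h].
Proof.
case: g h => [[[x y] z] [[p q] r]] [[[x' y'] z'] [[p' q'] r']].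
do 3!eexists; rewrite /commg /conjg /=.
(* [reflexivity] fills the existential entries with the computed ones; [ring] proves that the others
   are zero. *)
do !apply: pair_eq; try reflexivity; rewrite /=; ring.
Qed.

(** Modulo the corner entry [x], matrices with zero superdiagonal are central. *)
Lemma ut4_commg2 (g h : ut4) : ut4_level1 h -> ut4_level2 [~ g, h].
Proof.
case: g => [[[x y] z] [[p q] r]] [x' [y' [r' ->]]].
eexists; rewrite /commg /conjg /=.
do !apply: pair_eq; try reflexivity; rewrite /=; ring.
Qed.

Lemma ut4_commg3 (g h : ut4) : ut4_level2 h -> [~ g, h] = 1.
Proof.
case: g => [[[x y] z] [[p q] r]] [x' ->]; rewrite /commg /conjg /=.
do !apply: pair_eq; rewrite /=; ring.
Qed.

Lemma ut4_nilpotent : lower_central ut4 3 = [set 1].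
Proof.
apply/seteqP; split=> [|_ ->]; last exact: lower_central1.
apply: lower_central_sub => [|g h hL]; first exact: subgroup1.
apply/ut4_commg3; move: h hL.
apply: lower_central_sub => [|{}g h hL]; first exact: ut4_level2_subgroup.
apply/ut4_commg2; move: h hL.
apply: lower_central_sub => [|{}g h _]; first exact: ut4_level1_subgroup.
exact: ut4_commg1.
Qed.

(** * The split extension and the swaps *)

Definition ut4_kappa (v : vec3) : ut4 := (v, 1).
Fact ut4_kappa_is_hom : monoid_morphism ut4_kappa.
Proof. by split=> // [[[? ?] ?] [[? ?] ?]]; coords. Qed.
HB.instance Definition _ :=
  isUMagmaMorphism.Build vec3 ut4 ut4_kappa ut4_kappa_is_hom.

Definition ut4_alpha (g : ut4) : heis := g.2.
Fact ut4_alpha_is_hom : monoid_morphism ut4_alpha.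
Proof. by split=> // -[? ?] [? ?]. Qed.
HB.instance Definition _ :=
  isUMagmaMorphism.Build ut4 heis ut4_alpha ut4_alpha_is_hom.

Definition ut4_beta (m : heis) : ut4 := (1, m).
Fact ut4_beta_is_hom : monoid_morphism ut4_beta.
Proof. by split=> // [[[? ?] ?] [[? ?] ?]]; coords. Qed.
HB.instance Definition _ :=
  isUMagmaMorphism.Build heis ut4 ut4_beta ut4_beta_is_hom.

(** In general the first component is only a crossed homomorphism; here the Heisenberg part is
    trivial and does not act. This yields the factorization through the kernel. *)
Lemma ut4_kernel_is_hom (Z : groupType) (g : group_hom Z ut4) :
  (forall z, g z = ut4_kappa (g z).1) ->
  monoid_morphism (fun z => (g z).1 : vec3).
Proof.
move=> gE; split=> [|x y]; first by rewrite gmulf1.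
move: (gE x) (gE y); rewrite gmulfM /=; move: (g x) (g y) => gx gy -> ->.
exact: (esym (congr1 fst (ut4_kappa_is_hom.2 gx.1 gy.1))).
Qed.

Definition heis_incl (v : vec2) : heis := (v.1, 0%R, v.2).
Fact heis_incl_is_hom : monoid_morphism heis_incl.
Proof. by split=> // [[? ?] [? ?]]; coords. Qed.
HB.instance Definition _ :=
  isUMagmaMorphism.Build vec2 heis heis_incl heis_incl_is_hom.

Definition vec2_swap (v : vec2) : vec2 := (v.2, v.1).
Fact vec2_swap_is_hom : monoid_morphism vec2_swap.
Proof. by split=> // [[? ?] [? ?]]. Qed.
HB.instance Definition _ :=
  isUMagmaMorphism.Build vec2 vec2 vec2_swap vec2_swap_is_hom.

Definition vec3_swap (v : vec3) : vec3 := (v.1.1, v.2, v.1.2).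
Fact vec3_swap_is_hom : monoid_morphism vec3_swap.
Proof. by split=> // [[[? ?] ?] [[? ?] ?]]. Qed.
HB.instance Definition _ :=
  isUMagmaMorphism.Build vec3 vec3 vec3_swap vec3_swap_is_hom.

Lemma vec3_swapK : involutive vec3_swap. Proof. by case=> -[]. Qed.

(** The action only adds [a * y + c * z] to [x], which is unchanged when both (a, c) and (y, z) are
    swapped. *)
Lemma heis_act_swap (s : vec2) (v : vec3) :
  heis_act (heis_incl (vec2_swap s)) (vec3_swap v) =
  vec3_swap (heis_act (heis_incl s) v).
Proof. by case: s v => [a c] [[x y] z]; coords. Qed.

Lemma heis_act_swapV (s : vec2) (v : vec3) :
  heis_act (heis_incl s) (vec3_swap v) =
  vec3_swap (heis_act (heis_incl (vec2_swap s)) v).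
Proof. by rewrite -[v in RHS]vec3_swapK heis_act_swap vec3_swapK. Qed.

(** The first entry is the inverse of e23; e23 itself would give e13^-a. *)
Lemma heis_commg (a : int) :
  [~ ((0, -1, 0)%R : heis), heis_incl (a, 0%R)] = heis_incl (0%R, a).
Proof. by rewrite /commg /conjg /=; coords. Qed.

(** * Transporting a restriction along the swap of Z^3 *)

Section Conjugate.
Variables f f' : group_hom vec2 heis.
Hypothesis ff' : forall s v,
  heis_act (f' s) (vec3_swap v) = vec3_swap (heis_act (f s) v).

(** The [ut4] component of an isomorphism from the pullback along [f] to the pullback along [f']. *)
Definition fiber_conj (w : fiber (ut4_alpha : group_hom _ _) f) : ut4 :=
  (vec3_swap (val w).1.1, f' (val w).2).

Fact fiber_conj_is_hom : monoid_morphism fiber_conj.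
Proof.
split=> [|w w'].
  by rewrite /fiber_conj /=; apply: pair_eq; last exact: gmulf1.
(* Membership in the fiber product says that the Heisenberg part is [f s], so [ff'] applies to its
   action. *)
have /eqP /= ws := valP w.
rewrite /fiber_conj /= gmulfM; move: (val w) (val w') ws.
move=> [[v m] s] [[v' m'] s'] /=; rewrite /ut4_alpha /= => ->.
apply: pair_eq => //=.
rewrite [RHS](_ : _ = vec3_swap v * heis_act (f' s) (vec3_swap v')) //.
rewrite ff'; exact: vec3_swap_is_hom.2.
Qed.
HB.instance Definition _ :=
  isUMagmaMorphism.Build _ ut4 fiber_conj fiber_conj_is_hom.
Definition fiber_conj_hom : group_hom _ ut4 := fiber_conj.

Lemma fiber_conjK (w : fiber (ut4_alpha : group_hom _ _) f) :
  (vec3_swap (vec3_swap (val w).1.1), f (val w).2) = (val w).1.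
Proof.
by have /eqP /= <- := valP w; rewrite vec3_swapK [RHS]surjective_pairing.
Qed.

End Conjugate.

(** * The two split extensions among k-nilpotent groups *)

Section NotRepresentable.
Variables (k : nat) (hk : 3 <= k).

Lemma ut4_class : lower_central ut4 k = [set 1].
Proof. exact: lower_central_trivial ut4_nilpotent. Qed.

Lemma vec3_class : lower_central vec3 k = [set 1].
Proof. by apply: (lower_central_inj (f := ut4_kappa)) ut4_class => ? ? []. Qed.

Lemma heis_class : lower_central heis k = [set 1].
Proof. by apply: (lower_central_inj (f := ut4_beta)) ut4_class => ? ? []. Qed.

Lemma vec2_class : lower_central vec2 k = [set 1].
Proof.
by apply: (lower_central_inj (f := heis_incl)) heis_class => -[? ?] [? ?] [-> ->].
Qed.

Let C := nilpotent_groups k.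
Let A : C := NilGroup ut4_class.
Let X : C := NilGroup vec3_class.
Let B : C := NilGroup heis_class.
Let S : C := NilGroup vec2_class.
Let kappa : hom X A := ut4_kappa : group_hom vec3 ut4.
Let alpha : hom A B := ut4_alpha : group_hom ut4 heis.
Let beta : hom B A := ut4_beta : group_hom heis ut4.
Let incl : hom S B := heis_incl : group_hom vec2 heis.
Let swap2 : hom S S := vec2_swap : group_hom vec2 vec2.
Let swap3 : hom X X := vec3_swap : group_hom vec3 vec3.

Lemma ut4_split : alpha \oc beta = idm B.
Proof. exact: group_hom_eq. Qed.

Lemma ut4_kernel : is_kernel kappa alpha.
Proof.
split=> [|Z g g0]; first exact: group_hom_eq.
have gE z : (g : group_hom Z ut4) z = ut4_kappa (g z).1.
  have /= := congr1 (fun f : group_hom Z heis => f z) g0.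
  by rewrite /ut4_alpha; case: (g z) => v m /= ->.
have hM := ut4_kernel_is_hom gE.
pose H := isUMagmaMorphism.Build _ _ _ hM.
pose h : group_hom Z vec3 := HB.pack (fun z => (g z).1 : vec3) H.
exists h; split=> [|h' h'g]; apply: group_hom_eq => z /=; first by rewrite gE.
by rewrite -h'g.
Qed.

Lemma swap3K : swap3 \oc swap3 = idm X.
Proof. by apply: group_hom_eq => v; exact: vec3_swapK. Qed.

Let E1 : split_ext B X := SplitExt ut4_split ut4_kernel.
(** Only the kernel map differs from [E1], so restrictions of both are pullbacks of the same
    [alpha]. *)
Let E2 : split_ext B X := split_ext_twist E1 swap3K.

Section ConjugatePullback.
Variables (f f' : hom S B) (ff' : forall s v,
  heis_act ((f' : group_hom _ _) s) (vec3_swap v) =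
  vec3_swap (heis_act ((f : group_hom _ _) s) v)).

Definition pb_conj : hom (pb alpha f) A := fiber_conj_hom ff'.

Lemma pb_conj_comm : alpha \oc pb_conj = f' \oc pb2 alpha f.
Proof. exact: group_hom_eq. Qed.

End ConjugatePullback.

Lemma incl_swap_iso :
  split_ext_iso (split_ext_pb incl E1) (split_ext_pb (incl \oc swap2) E2).
Proof.
pose u := pb_conj (f := incl) (f' := incl \oc swap2) heis_act_swap.
(* The inverse uses the same construction with the two legs exchanged. *)
pose u' := pb_conj (f := incl \oc swap2) (f' := incl) heis_act_swapV.
have ue : alpha \oc u = (incl \oc swap2) \oc pb2 alpha incl.
  exact: pb_conj_comm.
have u'e : alpha \oc u' = incl \oc pb2 alpha (incl \oc swap2).
  exact: pb_conj_comm.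
exists (pb_lift ue); split.
- exists (pb_lift u'e); split; apply: pb_uniq;
    rewrite compA compm1 ?pb_lift1 ?pb_lift2 //; apply: group_hom_eq => w /=.
    exact: fiber_conjK.
  exact: fiber_conjK.
- apply: pb_uniq; rewrite compA ?pb_lift1 ?pb_lift2 //.
  exact: group_hom_eq.
- exact: pb_lift2.
- apply: pb_uniq; rewrite compA ?pb_lift1 ?pb_lift2 //.
  exact: group_hom_eq.
Qed.

(** * Contradiction from a representation *)

Section Representation.
Variables (T : C) (tau : forall D : C, SplExt D X -> hom D T).
Hypothesis tau_inj : forall D, injective (@tau D).
Hypothesis tau_nat : forall (D D' : C) (f : hom D' D) (c : SplExt D X),
  tau (SplExt_map f c) = tau c \oc f.

Let t1 : group_hom heis T := tau (SplExt_pi E1).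
Let t2 : group_hom heis T := tau (SplExt_pi E2).

Lemma t_swap (s : vec2) : t1 (heis_incl s) = t2 (heis_incl (vec2_swap s)).
Proof.
have : tau (SplExt_pi E1) \oc incl = tau (SplExt_pi E2) \oc (incl \oc swap2).
  rewrite -!tau_nat !SplExt_mapE; congr (tau _).
  exact/SplExt_piP/incl_swap_iso.
exact: (congr1 (fun g : group_hom vec2 T => g s)).
Qed.

(** The two claims are proved together: each one at level [j] gives the other at level [j.+1]. *)
Lemma t_lower_central (j : nat) (a : int) :
  lower_central T j (t1 (heis_incl (a, 0%R))) /\
  lower_central T j (t2 (heis_incl (a, 0%R))).
Proof.
elim: j => [//|j [IH1 IH2]].
have tR (t : group_hom heis T) : lower_central T j (t (heis_incl (a, 0%R))) ->
    lower_central T j.+1 (t (heis_incl (0%R, a))).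
  move=> ta K [_]; apply; rewrite -heis_commg gmulfR.
  by exists (t (0, -1, 0)%R) => //; exists (t (heis_incl (a, 0%R))).
split; first by rewrite t_swap; exact: tR t2 IH2.
have := tR t1 IH1; rewrite t_swap; exact.
Qed.

(** The zero map is kept inside [tau] composition so that naturality reads the right side as a
    restriction of [E1]. *)
Lemma t1_incl : tau (SplExt_pi E1) \oc incl = tau (SplExt_pi E1) \oc zerom S B.
Proof.
have e a : t1 (heis_incl (a, 0%R)) = 1.
  by have [+ _] := t_lower_central k a; rewrite nilgroupP.
have e' a : t1 (heis_incl (0%R, a)) = 1.
  by rewrite t_swap; have [_] := t_lower_central k a; rewrite nilgroupP.
apply: group_hom_eq => -[a c].
transitivity (1 : T); last exact: (esym (@gmulf1 _ _ t1)).
change (t1 (heis_incl (a, c)) = 1).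
have -> : heis_incl (a, c) = heis_incl (a, 0%R) * heis_incl (0%R, c) by coords.
by rewrite gmulfM /= e e' mulg1.
Qed.

Lemma ut4_not_representable : False.
Proof.
have : SplExt_pi (split_ext_pb incl E1) = SplExt_pi (split_ext_pb (zerom S B) E1).
  by rewrite -!SplExt_mapE; apply: tau_inj; rewrite !tau_nat t1_incl.
move/SplExt_piP => [theta [_ tk _ tb]].
pose P : groupType := nil_pb alpha (zerom S B).
pose F : group_hom (nil_pb alpha incl) P := theta.
(* [s] is e12, which moves the basis vector [v] to (1, 1, 0). *)
pose v : vec3 := (0, 1, 0)%R; pose s : vec2 := (1, 0)%R.
have kE (x : vec3) : (val (F (pb_kappa incl E1 x))).1 = ut4_kappa x.
  exact: (congr1 (fun g : group_hom vec3 P => (val (g x)).1) tk).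
(* In the restriction along the zero map the section has trivial [ut4] component. *)
have bE : (val (F (pb_beta incl E1 s))).1 = 1.
  exact: (congr1 (fun g : group_hom vec2 P => (val (g s)).1) tb).
(* The semidirect product relation, carried by [F] to [ut4_kappa] of (1, 1, 0) being equal to
   [ut4_kappa v], which is absurd. *)
have : F (pb_kappa incl E1 (heis_act (heis_incl s) v) * pb_beta incl E1 s) =
       F (pb_beta incl E1 s * pb_kappa incl E1 v).
  by congr (F _); apply: val_inj; coords.
by move/(congr1 (fun w => (val w).1)); rewrite !gmulfM /= !kE bE mulg1 mul1g.
Qed.

End Representation.

End NotRepresentable.

Theorem theorem2p1 (k : nat) (hk : 3 <= k) :
  ~ weakly_action_representable (nilpotent_groups k).
Proof.
by move/(_ (NilGroup (vec3_class hk))) => [T [tau [tau_inj tau_nat]]];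
  exact: ut4_not_representable tau_inj tau_nat.
Qed.
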